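(* Let $k$ be a field, let $A$ be a unital associative $k$-algebra and let $(\partial,\sigma;\bar\sigma,\hat\sigma)$ be a free right twisted multi-derivation on $A$. Let $(\Omega^1(A),d)$ be any first order differential calculus on $A$ finitely (but not necessarily freely) generated by elements $\omega_1,\dots,\omega_n\in\Omega^1(A)$ such that, for all $a\in A$ and $i=1,\dots,n$, $$\omega_ia=\sum_j\sigma_{ij}(a)\omega_j,\qquad a\omega_i=\sum_j\omega_j\bar\sigma_{ji}(a),\qquad da=\sum_i\partial_i(a)\omega_i=\sum_{i,j}\omega_i\bar\sigma_{ij}(\partial_j(a)).$$ Then the formula $$\nabla:\mathrm{Hom}_A(\Omega^1(A),A)\to A,\qquad f\mapsto\sum_i\partial_i^\sigma(f(\omega_i)),\qquad \partial_i^\sigma:=\sum_{j,k}\bar\sigma_{kj}\circ\partial_j\circ\hat\sigma_{ki},$$ defines a hom-connection on $A$ with respect to $\Omega^1(A)$.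
   Context: A first order differential calculus on $A$ is an $A$-bimodule $\Omega^1(A)$ with a $k$-linear map $d:A\to\Omega^1(A)$ satisfying $d(ab)=(da)b+a\,db$ (the degree-one part of a non-negatively graded differential graded algebra with degree-zero part $A$). A right twisted multi-derivation in $A$ is a pair $(\partial,\sigma)$, where $\sigma:A\to M_n(A)$, $\sigma(a)=(\sigma_{ij}(a))_{i,j=1}^n$, is an algebra homomorphism and $\partial:A\to A^n$, $\partial(a)=(\partial_i(a))_{i=1}^n$, is a $k$-linear map such that $\partial_i(ab)=\sum_j\partial_j(a)\sigma_{ji}(b)+a\partial_i(b)$ for all $a,b\in A$ and all $i$. Viewing maps $A\to M_n(A)$ as elements of $M_n(\mathrm{End}_k(A))$ with product $(\alpha\bullet\beta)_{ij}=\sum_k\alpha_{ik}\circ\beta_{kj}$, unit $\mathbb{I}$ and transpose $(\alpha^T)_{ij}=\alpha_{ji}$, the pair $(\partial,\sigma)$ is free if there exist algebra maps $\bar\sigma,\hat\sigma:A\to M_n(A)$ such that $\bar\sigma\bullet\sigma^T=\mathbb{I}=\sigma^T\bullet\bar\sigma$ and $\hat\sigma\bullet\bar\sigma^T=\mathbb{I}=\bar\sigma^T\bullet\hat\sigma$; one then writes $(\partial,\sigma;\bar\sigma,\hat\sigma)$. A hom-connection on $A$ with respect to $(\Omega^1(A),d)$ is a $k$-linear map $\nabla:\mathrm{Hom}_A(\Omega^1(A),A)\to A$ ($\mathrm{Hom}_A$ = right $A$-module maps) such that $\nabla(fa)=\nabla(f)a+f(da)$ for all $f\in\mathrm{Hom}_A(\Omega^1(A),A)$,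 $a\in A$, where $(fa)(\omega)=f(a\omega)$. *)

(* Defs.v *)
From HB Require Import structures.
From mathcomp Require Import all_boot all_algebra.
From mathcomp Require Import boolp functions.

Set Implicit Arguments.
Unset Strict Implicit.
Unset Printing Implicit Defensive.

Import GRing.Theory.
Local Open Scope ring_scope.

(* A-bimodules over a k-algebra A.  The library has one-sided modules only, and
   a type carries a single [*:]; here [*:] is the k-scaling, while the two
   actions of A are separate operations.  The axioms [lactZ] and [ractZ] say
   that k acts centrally: (c 1) w = c w = w (c 1). *)
HB.mixin Record Lmodule_isBimodule (k : fieldType) (A : algType k) W
    of GRing.Lmodule k W := {
  lact : A -> W -> W;
  ract : W -> A -> W;
  lact1 : forall w, lact 1 w = w;
  lactA : forall a b w, lact (a * b) w = lact a (lact b w);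
  lactDl : forall a b w, lact (a + b) w = lact a w + lact b w;
  lactDr : forall a u v, lact a (u + v) = lact a u + lact a v;
  lactZ : forall (c : k) a w, lact (c *: a) w = c *: lact a w;
  ract1 : forall w, ract w 1 = w;
  ractA : forall w a b, ract w (a * b) = ract (ract w a) b;
  ractDl : forall u v a, ract (u + v) a = ract u a + ract v a;
  ractDr : forall w a b, ract w (a + b) = ract w a + ract w b;
  ractZ : forall (c : k) w a, ract w (c *: a) = c *: ract w a;
  lractA : forall a w b, ract (lact a w) b = lact a (ract w b)
}.

HB.structure Definition Bimodule (k : fieldType) (A : algType k) :=
  {W of GRing.Lmodule k W & Lmodule_isBimodule k A W}.

Notation bimodType := (@Bimodule.type _).
Notation "a *< w" := (lact a w) (at level 40) : ring_scope.
Notation "w >* a" := (ract w a) (at level 40, left associativity) : ring_scope.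

Section Calculus.

Context {k : fieldType} {A : algType k}.

Definition is_calculus (W : bimodType A) (d : A -> W) : Prop :=
  linear d /\ forall a b : A, d (a * b) = d a >* b + a *< d b.

(* The sub-bimodule generated by the omega_i is the whole of W. *)
Definition generated_by (W : bimodType A) n (omega : 'I_n -> W) : Prop :=
  forall w : W, exists s : seq (A * 'I_n * A),
    w = \sum_(t <- s) (t.1.1 *< omega t.1.2 >* t.2).

Section RHom.

Variable W : bimodType A.

Definition rlinear : {pred W -> A} := fun f =>
  `[< (forall u v, f (u + v) = f u + f v) /\
      (forall w a, f (w >* a) = f w * a) >].

Lemma rlinearP (f : W -> A) :
  reflect ((forall u v, f (u + v) = f u + f v) /\
           (forall w a, f (w >* a) = f w * a)) (f \in rlinear).
Proof. exact: asboolP. Qed.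

Lemma rlinear_submod_closed : submod_closed rlinear.
Proof.
split.
  apply/rlinearP; split=> [u v|w a]; first by rewrite addr0.
  by rewrite mul0r.
move=> c f g /rlinearP[fD fM] /rlinearP[gD gM].
apply/rlinearP; split=> [u v|w a]; rewrite !fctE.
  by rewrite fD gD scalerDr addrACA.
by rewrite fM gM mulrDl scalerAl.
Qed.

HB.instance Definition _ :=
  GRing.isSubmodClosed.Build k (W -> A) rlinear rlinear_submod_closed.

(* Hom_A(W, A): right A-module maps, a k-subspace of the functions W -> A. *)
Record rhom := RHom { rhom_fun :> W -> A; rhom_rlinear : rhom_fun \in rlinear }.

HB.instance Definition _ := [isSub for rhom_fun].
HB.instance Definition _ := [Choice of rhom by <:].
HB.instance Definition _ := [SubChoice_isSubLmodule of rhom by <:].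

Lemma rhom_act_subproof (f : rhom) (a : A) :
  (fun w => f (a *< w)) \in rlinear.
Proof.
have /rlinearP[fD fM] := rhom_rlinear f.
by apply/rlinearP; split=> [u v|w b]; rewrite ?lactDr ?fD // -lractA fM.
Qed.

Definition rhom_act (f : rhom) (a : A) : rhom := RHom (rhom_act_subproof f a).

Definition is_hom_connection (d : A -> W) (nabla : rhom -> A) : Prop :=
  linear nabla /\
  forall (f : rhom) (a : A), nabla (rhom_act f a) = nabla f * a + f (d a).

End RHom.

End Calculus.

(* k-algebra maps A -> M_n(A) and k-linear maps A -> A^n.  As the library's
   scaling on matrices over A is by A, the scalar c in k acts on them as
   (c 1) *: _, which is entrywise scaling by c. *)
Notation "'{' 'mxalg' A , n '}'" :=
  {lrmorphism A -> 'M[A]_n | GRing.in_alg A \; *:%R}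
  (at level 0, A at level 100, n at level 99) : type_scope.
Notation "'{' 'rvlin' A , n '}'" :=
  {linear A -> 'rV[A]_n | GRing.in_alg A \; *:%R}
  (at level 0, A at level 100, n at level 99) : type_scope.

Section TwistedMultiDerivation.

Context {k : fieldType} {A : algType k} {n : nat}.

Definition twisted_multi_derivation
    (partial : {rvlin A, n}) (sigma : {mxalg A, n}) : Prop :=
  forall (a b : A) (i : 'I_n),
    partial (a * b) 0 i =
      (\sum_j partial a 0 j * sigma b j i) + a * partial b 0 i.

(* Maps A -> M_n(A) seen as n x n matrices of maps A -> A: entry (i, j) of
   alpha is the map a |-> alpha a i j. *)
Definition bullet (alpha beta : A -> 'M[A]_n) : A -> 'M[A]_n :=
  fun a => \matrix_(i, j) \sum_l alpha (beta a l j) i l.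

Definition bullet_unit : A -> 'M[A]_n := fun a => a%:M.

Definition bullet_tr (alpha : A -> 'M[A]_n) : A -> 'M[A]_n :=
  fun a => (alpha a)^T.

Definition bullet_inverse (alpha beta : A -> 'M[A]_n) : Prop :=
  bullet alpha beta =1 bullet_unit /\ bullet beta alpha =1 bullet_unit.

Definition free_twisted_multi_derivation (partial : {rvlin A, n})
    (sigma sigmabar sigmahat : {mxalg A, n}) : Prop :=
  [/\ twisted_multi_derivation partial sigma,
      bullet_inverse sigmabar (bullet_tr sigma) &
      bullet_inverse sigmahat (bullet_tr sigmabar)].

Definition partial_sigma (partial : {rvlin A, n})
    (sigmabar sigmahat : {mxalg A, n}) (i : 'I_n) : A -> A :=
  fun a => \sum_j \sum_l sigmabar (partial (sigmahat a l i) 0 j) l j.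

End TwistedMultiDerivation.

(* Main.v *)
Require Import Defs.
From HB Require Import structures.
From mathcomp Require Import all_boot all_algebra.

Set Implicit Arguments.
Unset Strict Implicit.
Unset Printing Implicit Defensive.

Import GRing.Theory.
Local Open Scope ring_scope.

(** Write delta = partial_sigma and x_i = f (omega_i), so that the formula reads
    nabla f = \sum_i delta_i (x_i).  Since a omega_i = \sum_j omega_j
    sigmabar_ji(a) and f is right A-linear, replacing f by f a replaces x_i by
    \sum_j x_j sigmabar_ji(a).  The theorem is therefore an identity in A alone,
      \sum_i delta_i (\sum_j x_j sigmabar_ji(a))
        = (\sum_i delta_i (x_i)) a + \sum_(j, p) x_j sigmabar_jp(partial_p(a)),
    valid for every family x of elements of A ([partial_sigma_leibniz]): by the
    second expression of d a, the last sum is f (d a).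

    The identity comes from computing delta from the inside out.
    - Inside, multiplicativity of sigmahat and sigmahat . sigmabar^T = I turn
      sigmahat_li(\sum_j x_j sigmabar_ji(a)), summed over i, into z_l a, where
      z_l = \sum_j sigmahat_lj(x_j) ([sigmahat_absorb]).
    - In the middle, the twisted Leibniz rule splits partial_p (z_l a) into
      \sum_q partial_q(z_l) sigma_qp(a) and z_l partial_p(a).
    - Outside, sigmabar . sigma^T = I absorbs the twist sigma_qp(a) of the first
      part and leaves \sum_q sigmabar_lq(partial_q(z_l)) a
      ([sigmabar_twisted_leibniz]); summed over l this is (nabla f) a.  In the
      second part, sigmabar^T . sigmahat = I gives \sum_l sigmabar_lm(z_l) = x_m
      ([sigmabar_sigmahat_cancel]), which leaves x_m sigmabar_mp(partial_p(a)).
*)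

Section FreeTwistedMultiDerivation.

Context {k : fieldType} {A : algType k} {n : nat}.

Lemma mxalg_entryM (phi : {mxalg A, n}) (a b : A) i j :
  phi (a * b) i j = \sum_m phi a i m * phi b m j.
Proof. by rewrite rmorphM -mulmxE mxE. Qed.

(** The scaling by c of a matrix over A is multiplication by c 1 on the left;
    on entries this is the k-scaling of A. *)
Lemma mxalg_entry_linear (phi : {mxalg A, n}) i j :
  linear (fun a => phi a i j).
Proof. by move=> c a b; rewrite linearP !mxE /= mulr_algl. Qed.

Lemma rvlin_entry_linear (phi : {rvlin A, n}) i : linear (fun a => phi a 0 i).
Proof. by move=> c a b; rewrite linearP !mxE /= mulr_algl. Qed.

Lemma sum_mul_diag (y : 'I_n -> A) (a : A) q :
  \sum_m y m * (a%:M : 'M_n) m q = y q * a.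
Proof.
rewrite (bigD1 q) //= big1 ?addr0 => [|m /negPf mq]; rewrite mxE ?eqxx //.
by rewrite mq mulr0.
Qed.

(** The form in which a one-sided inverse phi . psi^T = I of an algebra map is
    used: a factor psi_qp(a) to the right of y is absorbed by phi, once summed
    over the common index p. *)
Lemma bullet_tr_absorb (phi psi : {mxalg A, n}) (y a : A) l q :
    bullet phi (bullet_tr psi) =1 @bullet_unit _ _ _ ->
  \sum_p phi (y * psi a q p) l p = phi y l q * a.
Proof.
move=> phi_psi.
under eq_bigr do rewrite mxalg_entryM.
rewrite exchange_big /= -sum_mul_diag; apply: eq_bigr => m _.
rewrite -mulr_sumr -[a%:M]phi_psi mxE; congr (_ * _).
by apply: eq_bigr => p _; rewrite mxE.
Qed.

Variables (partial : {rvlin A, n}) (sigma sigmabar sigmahat : {mxalg A, n}).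

Lemma partial_sigma_linear i :
  linear (partial_sigma partial sigmabar sigmahat i).
Proof.
move=> c a b; rewrite scaler_sumr -big_split; apply: eq_bigr => j _ /=.
rewrite scaler_sumr -big_split; apply: eq_bigr => l _ /=.
by rewrite mxalg_entry_linear rvlin_entry_linear mxalg_entry_linear.
Qed.

Hypothesis hfree :
  free_twisted_multi_derivation partial sigma sigmabar sigmahat.

Lemma sigmahat_absorb (x : 'I_n -> A) (a : A) l :
  \sum_i sigmahat (\sum_j x j * sigmabar a j i) l i =
    \sum_j sigmahat (x j) l j * a.
Proof.
have [_ _ [hat_bar _]] := hfree.
under eq_bigr do rewrite raddf_sum summxE.
by rewrite exchange_big; apply: eq_bigr => j _; exact: bullet_tr_absorb.
Qed.

(** Applying sigmabar untwists the Leibniz rule: since sigmabar . sigma^T = I, a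
    comes out unchanged on the right of the first term, and only the second
    term keeps a twist, on its left factor z. *)
Lemma sigmabar_twisted_leibniz (z a : A) l :
  \sum_p sigmabar (partial (z * a) 0 p) l p =
    (\sum_q sigmabar (partial z 0 q) l q) * a +
    \sum_m sigmabar z l m * \sum_p sigmabar (partial a 0 p) m p.
Proof.
have [leibniz [bar_sigma _] _] := hfree.
under eq_bigr => p _ do
  rewrite leibniz raddfD mxE raddf_sum summxE mxalg_entryM.
rewrite big_split /=; congr (_ + _).
  rewrite exchange_big mulr_suml; apply: eq_bigr => q _.
  exact: bullet_tr_absorb.
by rewrite exchange_big; apply: eq_bigr => m _; rewrite mulr_sumr.
Qed.

(** Summing over i inside sigmahat, by additivity of the three maps, makes the
    absorption by sigmahat applicable. *)
Lemma sum_partial_sigma (x : 'I_n -> A) :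
  \sum_i partial_sigma partial sigmabar sigmahat i (x i) =
    \sum_l \sum_p sigmabar (partial (\sum_i sigmahat (x i) l i) 0 p) l p.
Proof.
rewrite /partial_sigma; under eq_bigr do rewrite exchange_big.
rewrite exchange_big; apply: eq_bigr => l _ /=.
rewrite exchange_big; apply: eq_bigr => p _ /=.
by rewrite raddf_sum summxE raddf_sum summxE.
Qed.

Lemma sigmabar_sigmahat_cancel (x : 'I_n -> A) m :
  \sum_l sigmabar (\sum_j sigmahat (x j) l j) l m = x m.
Proof.
have [_ _ [_ bar_hat]] := hfree.
under eq_bigr do rewrite raddf_sum summxE.
transitivity (\sum_j ((x j)%:M : 'M_n) m j).
  rewrite exchange_big; apply: eq_bigr => j _; rewrite -[_%:M]bar_hat mxE.
  by apply: eq_bigr => l _; rewrite mxE.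
rewrite (bigD1 m) //= big1 ?addr0 => [|j /negPf j_m]; rewrite mxE ?eqxx //.
by rewrite eq_sym j_m.
Qed.

(** The hom-connection property read on the values x_i of f at the generators
    omega_i. *)
Lemma partial_sigma_leibniz (x : 'I_n -> A) (a : A) :
  \sum_i partial_sigma partial sigmabar sigmahat i
            (\sum_j x j * sigmabar a j i) =
    (\sum_i partial_sigma partial sigmabar sigmahat i (x i)) * a +
    \sum_j x j * \sum_p sigmabar (partial a 0 p) j p.
Proof.
rewrite !sum_partial_sigma mulr_suml.
under eq_bigr => l _.
  rewrite sigmahat_absorb -mulr_suml sigmabar_twisted_leibniz; over.
rewrite big_split /=; congr (_ + _).
rewrite exchange_big; apply: eq_bigr => m _.
by rewrite -mulr_suml sigmabar_sigmahat_cancel.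
Qed.

End FreeTwistedMultiDerivation.

Theorem corollary3p5 (k : fieldType) (A : algType k) (n : nat)
    (partial : {rvlin A, n}) (sigma sigmabar sigmahat : {mxalg A, n})
    (hfree : free_twisted_multi_derivation partial sigma sigmabar sigmahat)
    (Omega : bimodType A) (d : A -> Omega) (hd : is_calculus d)
    (omega : 'I_n -> Omega) (homega : generated_by omega)
    (hright : forall (a : A) (i : 'I_n),
       omega i >* a = \sum_j (sigma a i j *< omega j))
    (hleft : forall (a : A) (i : 'I_n),
       a *< omega i = \sum_j (omega j >* sigmabar a j i))
    (hdl : forall a : A, d a = \sum_i (partial a 0 i *< omega i))
    (hdr : forall a : A,
       d a = \sum_i \sum_j (omega i >* sigmabar (partial a 0 j) i j)) :
  is_hom_connection d
    (fun f : rhom Omega =>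
       \sum_i partial_sigma partial sigmabar sigmahat i (f (omega i))).
Proof.
split=> [c f g|f a].
  rewrite scaler_sumr -big_split; apply: eq_bigr => i _.
  exact: partial_sigma_linear.
have /rlinearP[fD fM] := rhom_rlinear f.
have f0 : f 0 = 0 by apply: (addrI (f 0)); rewrite -fD !addr0.
have f_sum (F : 'I_n -> Omega) : f (\sum_i F i) = \sum_i f (F i).
  exact: (big_morph _ fD f0).
have ract_sum w (F : 'I_n -> A) : w >* (\sum_i F i) = \sum_i (w >* F i).
  apply: (big_morph _ (ractDr w)).
  by apply: (addrI (w >* 0)); rewrite -ractDr !addr0.
have -> : f (d a) =
    \sum_j f (omega j) * \sum_p sigmabar (partial a 0 p) j p.
  by rewrite hdr f_sum; apply: eq_bigr => j _; rewrite -ract_sum fM.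
rewrite -(partial_sigma_leibniz hfree); apply: eq_bigr => i _.
congr partial_sigma; rewrite /= hleft f_sum.
by apply: eq_bigr => j _; rewrite fM.
Qed.
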